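(* Let $(X,d)$ be an unbounded metric space. A subset $Y$ of $X$ is asymptotically scattered if and only if, for every $p\in X^\#$, the subset $\bigtriangleup_p(Y)$ is ultrabounded in $\overline{\overline{p}}$.
   Context: For $x\in X$, $r\geqslant 0$, $A\subseteq X$: $B(x,r)=\{y\in X: d(x,y)\leqslant r\}$ and $B(A,r)=\bigcup_{a\in A}B(a,r)$. A subset $V\subseteq X$ is bounded if $V\subseteq B(x,r)$ for some $x\in X$, $r\geqslant 0$. These notions apply to any metric space. A subset $Z$ of a metric space $M$ has asymptotically isolated $m$-balls, $m\in\omega=\{0,1,2,\dots\}$, if for every $n\in\omega$ there exist $n'>n$ and $z\in Z$ such that $B(z,n')\setminus B(z,m)=\varnothing$ (balls taken in $M$). $Z$ has asymptotically isolated balls if it has asymptotically isolated $m$-balls for some $m\in\omega$. A metric space $M$ is asymptotically scattered if each unbounded subset of $M$ has asymptotically isolated balls. A subset $Y$ of $X$ is asymptotically scattered if the metric space $(Y,d_Y)$, where $d_Y$ is the restriction of $d$ to $Y$, is asymptotically scattered (so here balls are taken in $Y$). $\beta X$ denotes the set of all ultrafilters on $X$ (the Stone-Čech compactification of $X$ with the discrete topology). For $Y\subseteq X$, $Y^\#=\{p\in\beta X: Y\in p \text{ and each } P\in p \text{ is unbounded in } X\}$; in particular $X^\#$ is the set of all ultrafilters on $X$ all of whose members are unbounded. For $p,q\in X^\#$ write $p\parallel q$ if there is $r\geqslant 0$ such that $B(Q,r)\in p$ for each $Q\in q$ (this is an equivalence relation, called parallel equivalence). Put $\overline{\overline{p}}=\{q\in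 X^\#: p\parallel q\}$ and, for $Y\subseteq X$, $\bigtriangleup_p(Y)=\overline{\overline{p}}\cap Y^\#$. A subset $S\subseteq\overline{\overline{p}}$ is ultrabounded with respect to $p$ if there is $r\geqslant 0$ such that, for each $q\in S$ and every $Q\in q$, we have $B(Q,r)\in p$. This property does not change if $p$ is replaced by any $q\in\overline{\overline{p}}$, and one then says that $S$ is ultrabounded in $\overline{\overline{p}}$. *)

(* Defs.v *)
From HB Require Import structures.
From mathcomp Require Import all_boot all_order all_algebra.
From mathcomp Require Import all_classical all_reals all_analysis.

Set Implicit Arguments.
Unset Strict Implicit.
Unset Printing Implicit Defensive.

Import Order.TTheory GRing.Theory Num.Theory.

Local Open Scope classical_set_scope.
Local Open Scope ring_scope.

(* A subset [Y] of a metric space, seen as the type [set_type Y], already has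
   the induced pseudometric structure; the restricted distance makes it a
   metric space. *)
Section subset_metric.
Context {R : realType} {X : metricType R} (Y : set X).

Let dist (x y : Y) : R := mdist (\val x) (\val y).

Let dist_ge0 x y : 0 <= dist x y.
Proof. exact: mdist_ge0. Qed.

Let dist_positivity x y : dist x y = 0 -> x = y.
Proof. by move=> /mdist_positivity; exact: val_inj. Qed.

Let ballEdist (x : Y) e : ball x e = [set y | dist x y < e].
Proof.
by rewrite /ball/= /initial_ball/= ballEmdist.
Qed.

HB.instance Definition _ := @PseudoMetric_isMetric.Build R (set_type Y)
  dist dist_ge0 dist_positivity ballEdist.

End subset_metric.

Section balls.
Context {R : realType} {M : metricType R}.

(* Not [closed_ball], which is the closure of an open ball. *)
Definition mball (x : M) (r : R) : set M := [set y | mdist x y <= r].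

Definition mball_set (A : set M) (r : R) : set M :=
  \bigcup_(a in A) mball a r.

(* The first disjunct only matters when [M] is empty: it makes the empty subset
   of the empty space bounded, although there is no center [x] to choose. *)
Definition mbounded (V : set M) : Prop :=
  V = set0 \/ exists x : M, exists2 r : R, 0 <= r & V `<=` mball x r.

Definition asymptotically_isolated_mballs (Z : set M) (m : nat) : Prop :=
  forall n : nat, exists2 n' : nat, (n < n')%N &
    exists2 z : M, Z z & mball z n'%:R `\` mball z m%:R = set0.

Definition asymptotically_isolated_balls (Z : set M) : Prop :=
  exists m : nat, asymptotically_isolated_mballs Z m.

End balls.

Definition asymptotically_scattered {R : realType} (M : metricType R) : Prop :=
  forall Z : set M, ~ mbounded Z -> asymptotically_isolated_balls Z.

(* Balls and boundedness are those of [Y] with the restricted distance. *)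
Definition asymptotically_scattered_subset {R : realType} {X : metricType R}
  (Y : set X) : Prop := asymptotically_scattered (set_type Y).

Section ultrafilters.
Context {R : realType} {X : metricType R}.

(* [sharp Y] is $Y^\#$; in particular [sharp setT] is $X^\#$. *)
Definition sharp (Y : set X) : set (set_system X) :=
  [set p | [/\ UltraFilter p, p Y & forall P, p P -> ~ mbounded P]].

Definition parallel (p q : set_system X) : Prop :=
  exists2 r : R, 0 <= r & forall Q, q Q -> p (mball_set Q r).

Definition parallel_class (p : set_system X) : set (set_system X) :=
  [set q | sharp setT q /\ parallel p q].

(* $\bigtriangleup_p(Y)$ *)
Definition triangle (p : set_system X) (Y : set X) : set (set_system X) :=
  parallel_class p `&` sharp Y.

Definition ultrabounded (p : set_system X) (S : set (set_system X)) : Prop :=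
  S `<=` parallel_class p /\
  exists2 r : R, 0 <= r & forall q, S q -> forall Q, q Q -> p (mball_set Q r).

End ultrafilters.

(* Main.v *)
Require Import Defs.
From mathcomp Require Import all_boot all_order all_algebra.
From mathcomp Require Import all_classical all_reals all_analysis.
From mathcomp Require Import unstable lra.

(* An unbounded [Z] fails to have isolated balls iff for every [m] there is [s]
   such that each [z] in [Z] has a point [y] with [m < d(z, y) <= s].
   If [Y] is not scattered, take an ultrafilter [p] on a sequence in such a [Z]
   whose mutual distances tend to infinity, and push it along [z |-> y]: the
   image is parallel to [p], but sparseness lets no radius below [m] witness this.
   Conversely, if the class of [p] is not ultrabounded on [Y], fix [q0] in it;
   for each [m] another ultrafilter of the class makes [q0]-almost every point [z]
   have a [y] in [Y] with [m < d(z, y) <= s m], and a diagonal sequence of such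
   points is an unbounded set without isolated balls. *)

Set Implicit Arguments.
Unset Strict Implicit.
Unset Printing Implicit Defensive.

Import Order.TTheory GRing.Theory Num.Theory.

Local Open Scope classical_set_scope.
Local Open Scope ring_scope.

Section metric_balls.
Context {R : realType} {M : metricType R}.

(** Moving the centre changes distances by a bounded amount, so a single base point detects
    unboundedness. *)
Lemma unboundedP (x0 : M) (V : set M) :
  ~ mbounded V <-> forall r, exists2 y, V y & r < mdist x0 y.
Proof.
split=> [nbV r|farV [V0|[x [r _ Vr]]]].
- apply: contrapT => noy; apply: nbV; right; exists x0, `|r| => // y Vy /=.
  rewrite /mball/= leNgt; apply/negP => ry; apply: noy; exists y => //.
  by rewrite (le_lt_trans (ler_norm r)).
- by have [y] := farV 0; rewrite V0.
- have [y /Vr] := farV (mdist x0 x + r); rewrite /mball/=.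
  have := metric_triangle x0 x y; lra.
Qed.

Lemma unbounded_nonempty (V : set M) : ~ mbounded V -> V !=set0.
Proof. by move=> nbV; apply/set0P/eqP => V0; apply: nbV; left. Qed.

Lemma not_isolatedP (Z : set M) :
  ~ asymptotically_isolated_balls Z <->
  forall m : nat, exists s : R, forall z, Z z ->
    exists2 y, m%:R < mdist z y & mdist z y <= s.
Proof.
split=> [nisoZ m|annZ [m isoZ]].
- apply: contrapT => nos; apply: nisoZ; exists m => n.
  exists n.+1 => //; apply: contrapT => noz; apply: nos; exists n.+1%:R => z Zz.
  apply: contrapT => noy; apply: noz; exists z => //.
  apply/seteqP; split=> // y [/= zy /negP]; rewrite -ltNge => my.
  by apply: noy; exists y.
- have [s annZs] := annZ m.
  have [n' nn' [z Zz isoz]] := isoZ (Num.bound s).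
  have [y my ys] := annZs z Zz.
  suff : (mball z n'%:R `\` mball z m%:R) y by rewrite isoz.
  split; last by move/(lt_le_trans my); rewrite ltxx.
  rewrite /mball/= (le_trans ys)// (le_trans (ltW (ltr_bound s)))//.
  by rewrite ler_nat ltnW.
Qed.

(* The first [m] terms have annuli around them because the space is unbounded. *)
Lemma annuli_of_eventual (z : nat -> M) :
  ~ mbounded [set: M] ->
  (forall m : nat, exists s : R, forall k, (m <= k)%N ->
    exists2 y, m%:R < mdist (z k) y & mdist (z k) y <= s) ->
  ~ asymptotically_isolated_balls (range z).
Proof.
move=> nbM annz; apply/not_isolatedP => m.
have [s anns] := annz m.
have [t annt] : exists t : R, forall k, (k < m)%N ->
    exists2 y, m%:R < mdist (z k) y & mdist (z k) y <= t.
  (* Induction on the number of terms only: the inner radius [m] stays fixed. *)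
  elim: {-2}m => [|j [t annt]]; first by exists 0.
  have [y _ my] := (unboundedP (z j) _).1 nbM m%:R.
  exists (Num.max t (mdist (z j) y)) => k; rewrite ltnS leq_eqVlt.
  case/orP => [/eqP ->|/annt[y' my' y't]]; last first.
    by exists y' => //; rewrite le_max y't.
  by exists y => //; rewrite le_max lexx orbT.
exists (Num.max s t) => _ [k _ <-].
have [/anns|/annt] := leqP m k => -[y my ys]; exists y => //;
  by rewrite le_max ys ?orbT.
Qed.

Lemma sparse_sequence (Z : set M) : ~ mbounded Z ->
  exists z : nat -> M, [/\ forall k, Z (z k),
    forall x r, exists K : nat, forall k, (K <= k)%N -> r < mdist x (z k) &
    forall j k, (j < k)%N -> k%:R < mdist (z j) (z k)].
Proof.
move=> nbZ; have [x0 Zx0] := unbounded_nonempty nbZ.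
have /choice[g Zg] (r : R) : exists y, Z y /\ r < mdist x0 y.
  by have [y] := (unboundedP x0 _).1 nbZ r; exists y.
(* Each term exceeds the previous one in distance to [x0] by more than its own index, so the
   triangle inequality separates it from all earlier terms. *)
pose z := fix z k : M :=
  if k is j.+1 then g (mdist x0 (z j) + j.+1%:R) else g 0.
have step k : mdist x0 (z k) + k.+1%:R < mdist x0 (z k.+1) by exact: (Zg _).2.
have grow j k : (j < k)%N -> mdist x0 (z j) + k%:R < mdist x0 (z k).
  elim: k => // k IHk; rewrite ltnS leq_eqVlt => /orP[/eqP ->|/IHk jk] //.
  have := step k; have : (0 : R) <= k%:R by [].
  lra.
have far k : k%:R <= mdist x0 (z k).
  case: k => [|k]; first exact: mdist_ge0.
  have := step k; have := mdist_ge0 x0 (z k); lra.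
exists z; split; first by case=> [|k]; exact: (Zg _).1.
- move=> x r; exists (Num.bound (mdist x0 x + r)) => k.
  rewrite -(ler_nat R); have := ltr_bound (mdist x0 x + r).
  have := far k; have := metric_triangle x0 x (z k); lra.
- move=> j k jk; have := grow j k jk.
  have := metric_triangle x0 (z j) (z k); lra.
Qed.

End metric_balls.

Lemma ultrafilter_fmap (T U : Type) (f : T -> U) (F : set_system T) :
  UltraFilter F -> UltraFilter (f @ F).
Proof.
move=> FU; split=> [|G GF fFG]; first exact: fmap_proper_filter.
apply/seteqP; split=> // A GA; rewrite fmapE.
have [//|FnA] := in_ultra_setVsetC (f @^-1` A) FU.
have /(filterI GA) : G (~` A) by apply: fFG; rewrite fmapE.
by rewrite setICr => /filter_not_empty.
Qed.

Section subset.
Context {R : realType} {X : metricType R} (Y : set X).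

Lemma mdist_set_val (a b : Y) : mdist a b = mdist (val a) (val b).
Proof. by []. Qed.

(** Every member of [u] meets every tail of the indices, so every member of the image contains
    arbitrarily far terms of [w]. *)
Lemma sharp_fmap (V : set X) (u : set_system nat) (w : nat -> X) :
  UltraFilter u -> \oo `<=` u -> (forall k, V (w k)) ->
  (forall x r, exists K : nat, forall k, (K <= k)%N -> r < mdist x (w k)) ->
  sharp V (w @ u).
Proof.
move=> uU u_oo wV farw; split; first exact: ultrafilter_fmap.
- by rewrite fmapE; apply: filterS filterT => k _; exact: wV.
- move=> P; rewrite fmapE => uP; apply/(unboundedP (w 0%N)) => r.
  have [K farK] := farw (w 0%N) r.
  have uK : u [set k | (K <= k)%N] by apply: u_oo; exists K.
  have [k [Pk /farK]] := filter_ex (filterI uP uK).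
  by exists (w k).
Qed.

Lemma ultrabounded_scattered :
  (forall p : set_system X, sharp [set: X] p -> ultrabounded p (triangle p Y)) ->
  asymptotically_scattered_subset Y.
Proof.
move=> ubY Z nbZ; apply: contrapT => /not_isolatedP annZ.
have [z [Zz farz sepz]] := sparse_sequence nbZ.
have [u [uU u_oo]] := ultraFilterLemma eventually_filter.
have farvz x r : exists K : nat, forall k, (K <= k)%N -> r < mdist x (val (z k)).
  have [K farK] := farz (z 0%N) (mdist (val (z 0%N)) x + r).
  exists K => k /farK; rewrite mdist_set_val.
  have := metric_triangle (val (z 0%N)) x (val (z k)); lra.
have sharpp : sharp setT ((val \o z) @ u) by exact: sharp_fmap.
have [_ [r r0 ubr]] := ubY _ sharpp.
(* The annuli are taken beyond the radius [r] that is to be refuted. *)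
pose m := Num.bound r; have [s anns] := annZ m.
have /choice[f fz] k : exists y, m%:R < mdist (z k) y /\ mdist (z k) y <= s.
  by have [y] := anns _ (Zz k); exists y.
have mr : r < m%:R by exact: ltr_bound.
have s0 : 0 <= s by have := fz 0%N; have := mdist_ge0 (z 0%N) (f 0%N); lra.
have trq : triangle ((val \o z) @ u) Y ((val \o f) @ u).
  have sharpf (W : set X) : (forall k, W (val (f k))) ->
      sharp W ((val \o f) @ u).
    move=> Wf; apply: sharp_fmap => // x r1.
    have [K farK] := farvz x (r1 + s).
    exists K => k /farK; have := (fz k).2; rewrite mdist_set_val.
    have := metric_triangle x (val (f k)) (val (z k)).
    rewrite (metric_sym (val (f k))) /=; lra.
  split; last by apply: sharpf => k; exact: set_valP.
  split; first exact: sharpf.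
  exists s => // Q; rewrite !fmapE; apply: filterS => k Qk.
  exists (val (f k)) => //; rewrite /mball/= metric_sym; exact: (fz k).2.
(* From index [K] on, distinct terms of [z] are more than [r + s] apart. Hence [f j] within [r] of
   [z k] forces [j = k], against [r < m]. *)
pose K := Num.bound (r + s).
have uK : u [set k | (K <= k)%N] by apply: u_oo; exists K.
have /(ubr _ trq) : ((val \o f) @ u) ((val \o f) @` [set k | (K <= k)%N]).
  by rewrite fmapE; apply: filterS uK => k Kk; exists k.
rewrite fmapE => /(filterI uK)/filter_ex[k [/= Kk [_ [j /= Kj <-]]]].
rewrite /mball/= -mdist_set_val => fjzk.
have far_neq : j != k -> r + s < mdist (z j) (z k).
  have rsK : r + s < K%:R by exact: ltr_bound.
  rewrite neq_ltn => /orP[/sepz|/sepz]; [|rewrite metric_sym].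
    by apply: lt_trans; rewrite (lt_le_trans rsK)// ler_nat.
  by apply: lt_trans; rewrite (lt_le_trans rsK)// ler_nat.
case: (eqVneq j k) => [jk|/far_neq].
- subst j. have := (fz k).1; have := metric_sym (z k) (f k); lra.
- have := (fz j).2; have := metric_triangle (z j) (f j) (z k); lra.
Qed.

Lemma scattered_ultrabounded (p : set_system X) :
  asymptotically_scattered_subset Y ->
  sharp [set: X] p -> ultrabounded p (triangle p Y).
Proof.
move=> scY [pU _ _]; split; first by move=> q [].
apply: contrapT => nub.
have [q0 [[_ [r0 r00 parq0]] [q0U q0Y nbq0]]] : triangle p Y !=set0.
  apply/set0P/eqP => tr0; apply: nub; exists 0 => // q; by rewrite tr0.
pose ann (m : nat) (s : R) : set X :=
  [set z | exists y, [/\ Y y, m%:R < mdist z y & mdist z y <= s]].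
have /choice[s q0ann] m : exists s, q0 (ann m s).
  apply: contrapT => noann.
  (* A set [Q] whose [m]-ball lies in [q0] has its ball of radius [m + r0] in [p]; so a [Q] failing
     this radius has the complement of its [m]-ball in [q0]. *)
  apply: nub; exists (m%:R + r0); first by rewrite addr_ge0.
  move=> q trq Q qQ; apply: contrapT => npQ; apply: noann.
  have [[_ [t t0 parq]] [qU qY _]] := trq.
  have pt : p (mball_set (Q `&` Y) t) by apply: parq; exact: filterI.
  exists (r0 + t).
  have q0far : q0 (~` mball_set Q m%:R).
    have [q0Q|//] := in_ultra_setVsetC (mball_set Q m%:R) q0U.
    exfalso; apply: npQ; apply: filterS (parq0 _ q0Q) => x [z [y Qy yz] zx].
    exists y => //; move: yz zx; rewrite /mball/=.
    have := metric_triangle y z x; lra.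
  (* Otherwise [p] has a point within [t] of [Q] in [Y] and within [r0] of a point that is farther
     than [r0 + t] from that set. *)
  have q0near : q0 (mball_set (Q `&` Y) (r0 + t)).
    have [//|/parq0 pC] := in_ultra_setVsetC (mball_set (Q `&` Y) (r0 + t)) q0U.
    have [x [[z nz zx] [y QYy yx]]] := filter_ex (filterI pC pt).
    exfalso; apply: nz; exists y => //; move: zx yx; rewrite /mball/=.
    have := metric_triangle y x z; rewrite (metric_sym x z); lra.
  apply: filterS (filterI q0far q0near) => z [nz [y [Qy Yy] yz]].
  exists y; rewrite metric_sym; split=> //.
  by rewrite ltNge; apply/negP => zy; apply: nz; exists y.
have q0anns k : q0 [set z | forall i, (i < k)%N -> ann i (s i) z].
  elim: k => [|k IHk]; first exact: filterS filterT.
  apply: filterS (filterI IHk (q0ann k)) => x [annx annkx] i.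
  by rewrite ltnS leq_eqVlt => /orP[/eqP->|/annx].
have [x0 Yx0] := unbounded_nonempty (nbq0 _ q0Y).
have /choice[z zP] k : exists z : Y, k%:R < mdist x0 (val z) /\
    forall i, (i <= k)%N -> ann i (s i) (val z).
  (* Diagonal choice: the [k]-th point serves all inner radii up to [k] at once, hence [k.+1], and
     lies far out because members of [q0] are unbounded. *)
  have [x [annx Yx] farx] :=
    (unboundedP x0 _).1 (nbq0 _ (filterI (q0anns k.+1) q0Y)) k%:R.
  by exists (SigSub (mem_set Yx)).
pose y0 : Y := SigSub (mem_set Yx0).
have nbz : ~ mbounded (range z).
  apply/(unboundedP y0) => r; exists (z (Num.bound r)); first by exists (Num.bound r).
  exact: lt_trans (ltr_bound r) (zP _).1.
(* [Y] itself is unbounded since it contains the range of [z]. *)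
apply: (annuli_of_eventual _ _ (scY _ nbz)).
  apply/(unboundedP y0) => r.
  by have [y _ ry] := (unboundedP y0 _).1 nbz r; exists y.
move=> m; exists (s m) => k mk.
have [y [Yy my ys]] := (zP k).2 m mk.
by exists (SigSub (mem_set Yy)).
Qed.

End subset.

Theorem theorem4p4 (R : realType) (X : metricType R)
    (unboundedX : ~ mbounded [set: X]) (Y : set X) :
  asymptotically_scattered_subset Y <->
  (forall p : set_system X, sharp [set: X] p -> ultrabounded p (triangle p Y)).
Proof.
split=> [scY p|]; first exact: scattered_ultrabounded.
exact: ultrabounded_scattered.
Qed.
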